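(* For any Schauder basis $(y_k)$ of $\ell_2$, we have $E(\ell_2,(y_k))\sim_B\mathbb{R}^{\mathbb{N}}/\ell_2$.
   Context: $\mathbb{N}=\{0,1,2,\dots\}$ and $\ell_2$ is the real Hilbert space of square-summable sequences. For a sequence $(x_n)$ in a Banach space $X$, $\mathrm{coef}(X,(x_n))=\{a\in\mathbb{R}^{\mathbb{N}}:\sum_n a(n)x_n\text{ converges in }X\}$, and $E(X,(x_n))$ is the equivalence relation on $\mathbb{R}^{\mathbb{N}}$ given by $(a,b)\in E(X,(x_n))\iff a-b\in\mathrm{coef}(X,(x_n))$. $\mathbb{R}^{\mathbb{N}}/\ell_2$ is the equivalence relation on $\mathbb{R}^{\mathbb{N}}$ in which $a,b$ are equivalent iff $a-b\in\ell_2$. For equivalence relations $E,F$ on Polish spaces $Z,W$, $E\le_B F$ means there is a Borel function $\theta:Z\to W$ with $(x,y)\in E\iff(\theta(x),\theta(y))\in F$ for all $x,y\in Z$; $E\sim_B F$ means $E\le_B F$ and $F\le_B E$. *)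

(* Defs.v *)
From HB Require Import structures.
From mathcomp Require Import all_boot all_order all_algebra.
From mathcomp Require Import all_classical all_reals all_analysis.
From mathcomp Require Import ring lra.

Set Implicit Arguments.
Unset Strict Implicit.
Unset Printing Implicit Defensive.

Import Order.TTheory GRing.Theory Num.Theory.
Import numFieldNormedType.Exports.

Local Open Scope classical_set_scope.
Local Open Scope ring_scope.

Section square_summable.
Context {R : realType}.
Implicit Types (a b : R^nat) (c M : R).

Definition square_summable : {pred R^nat} :=
  mem [set a : R^nat | cvgn (series (fun n => a n ^+ 2))].

Definition sqnorm a : R := limn (series (fun n => a n ^+ 2)).

Lemma nd_series_sq a : nondecreasing_seq (series (fun n => a n ^+ 2)).
Proof. by apply: nondecreasing_series => n _ _; exact: sqr_ge0. Qed.

Lemma square_summable_le a M :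
  (forall N, series (fun n => a n ^+ 2) N <= M) ->
  a \in square_summable /\ sqnorm a <= M.
Proof.
move=> aM.
have ca : cvgn (series (fun n => a n ^+ 2)).
  apply: nondecreasing_is_cvgn; first exact: nd_series_sq.
  by exists M => _ [N _ <-].
split; first by rewrite inE.
by apply: limr_le => //; apply: nearW => N; exact: aM.
Qed.

Lemma series_sq_le a N : a \in square_summable ->
  series (fun n => a n ^+ 2) N <= sqnorm a.
Proof.
by rewrite inE => ca; apply: nondecreasing_cvgn_le => //; exact: nd_series_sq.
Qed.

Lemma sqnorm_ge0 a : a \in square_summable -> 0 <= sqnorm a.
Proof. by move=> /(@series_sq_le a 0%N); rewrite seriesEnat /= big_geq. Qed.

Lemma sqr_le_sqnorm a k : a \in square_summable -> a k ^+ 2 <= sqnorm a.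
Proof.
move=> /(@series_sq_le a k.+1); apply: le_trans.
rewrite seriesEnat /= big_nat_recr//= lerDr.
by apply: sumr_ge0 => i _; exact: sqr_ge0.
Qed.

Lemma sqnorm_eq0 a : a \in square_summable -> sqnorm a = 0 -> a = 0.
Proof.
move=> sa a0; apply/funext => k; apply/eqP; rewrite -sqrf_eq0.
by rewrite eq_le sqr_ge0 andbT -a0 sqr_le_sqnorm.
Qed.

Lemma square_summableZ c a : a \in square_summable ->
  c *: a \in square_summable /\ sqnorm (c *: a) = c ^+ 2 * sqnorm a.
Proof.
rewrite inE => ca.
have E : (fun n => (c *: a) n ^+ 2) = c ^+ 2 *: (fun n => a n ^+ 2).
  by apply/funext => n; rewrite /GRing.scale /= exprMn.
by rewrite inE /sqnorm /= E; split; [exact: is_cvg_seriesZ|rewrite lim_seriesZ].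
Qed.

Lemma square_summableD a b : a \in square_summable -> b \in square_summable ->
  a + b \in square_summable /\
  sqnorm (a + b) <= (Num.sqrt (sqnorm a) + Num.sqrt (sqnorm b)) ^+ 2.
Proof.
move=> sa sb; have a0 := sqnorm_ge0 sa; have b0 := sqnorm_ge0 sb.
have [za|za] := eqVneq (sqnorm a) 0.
  by rewrite za sqrtr0 add0r sqr_sqrtr// (sqnorm_eq0 sa za) add0r.
have [zb|zb] := eqVneq (sqnorm b) 0.
  by rewrite zb sqrtr0 addr0 sqr_sqrtr// (sqnorm_eq0 sb zb) addr0.
apply: square_summable_le => N.
set s := Num.sqrt (sqnorm a); set t := Num.sqrt (sqnorm b).
have s0 : 0 < s by rewrite sqrtr_gt0 lt_neqAle eq_sym za.
have t0 : 0 < t by rewrite sqrtr_gt0 lt_neqAle eq_sym zb.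
have -> : (s + t) ^+ 2 = (1 + t / s) * sqnorm a + (1 + s / t) * sqnorm b.
  rewrite -(sqr_sqrtr a0) -(sqr_sqrtr b0) -/s -/t.
  by field; rewrite !gt_eqF.
have ht : 0 <= 1 + t / s by rewrite addr_ge0// divr_ge0// ltW.
have hs : 0 <= 1 + s / t by rewrite addr_ge0// divr_ge0// ltW.
apply: (@le_trans _ _ ((1 + t / s) * series (fun n => a n ^+ 2) N
                     + (1 + s / t) * series (fun n => b n ^+ 2) N)).
  rewrite !seriesEnat /= !mulr_sumr -big_split /=; apply: ler_sum => i _.
  rewrite -subr_ge0.
  have -> : (1 + t / s) * a i ^+ 2 + (1 + s / t) * b i ^+ 2 - (a + b) i ^+ 2
          = (t * a i - s * b i) ^+ 2 / (s * t).
    by rewrite -[(a + b) i]/(a i + b i); field; rewrite !gt_eqF.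
  by rewrite divr_ge0 ?sqr_ge0// mulr_ge0// ltW.
by apply: lerD; apply: ler_wpM2l => //; exact: series_sq_le.
Qed.

Lemma square_summable_submod : submod_closed square_summable.
Proof.
split; first by case: (@square_summable_le 0 0) => // N;
  rewrite seriesEnat /= big1// => i _; rewrite expr0n.
move=> c a b sa sb; apply: (proj1 (square_summableD _ sb)).
exact: (proj1 (square_summableZ c sa)).
Qed.

HB.instance Definition _ :=
  GRing.isSubmodClosed.Build _ _ square_summable square_summable_submod.

End square_summable.

Record ell2 (R : realType) := Ell2 {
  ell2_val :> nat -> R ;
  _ : ell2_val \in square_summable }.

Section ell2_normed.
Context {R : realType}.

HB.instance Definition _ := [isSub for @ell2_val R].
HB.instance Definition _ := [Choice of ell2 R by <:].
HB.instance Definition _ := [SubChoice_isSubLmodule of ell2 R by <:].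

Definition ell2_norm (x : ell2 R) : R :=
  Num.sqrt (limn (series (fun n => x n ^+ 2))).

Lemma ell2_normD x y : ell2_norm (x + y) <= ell2_norm x + ell2_norm y.
Proof.
rewrite /ell2_norm -/(sqnorm _) -/(sqnorm x) -/(sqnorm y).
have [_ h] := square_summableD (valP x) (valP y).
rewrite -(@ger0_norm _ (_ + _)) ?addr_ge0 ?sqrtr_ge0//.
by rewrite -sqrtr_sqr; exact: ler_wsqrtr.
Qed.

Lemma ell2_normZ (c : R) x : ell2_norm (c *: x) = `|c| * ell2_norm x.
Proof.
rewrite /ell2_norm -/(sqnorm _) -/(sqnorm x).
have [_ h] := square_summableZ c (valP x).
rewrite (_ : (c *: x : ell2 R) = c *: (x : R^nat) :> R^nat)//.
by rewrite h sqrtrM ?sqr_ge0// sqrtr_sqr.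
Qed.

Lemma ell2_norm_eq0 x : ell2_norm x = 0 -> x = 0.
Proof.
rewrite /ell2_norm -/(sqnorm x) => /eqP; rewrite sqrtr_eq0 => x0.
apply: val_inj; apply: (sqnorm_eq0 (valP x)); apply/eqP.
by rewrite eq_le x0 sqnorm_ge0//; exact: valP.
Qed.

HB.instance Definition _ := Lmodule_isNormed.Build R (ell2 R)
  ell2_normD ell2_normZ ell2_norm_eq0.

Lemma ell2_normE (x : ell2 R) :
  `|x| = Num.sqrt (limn (series (fun n => x n ^+ 2))).
Proof. by []. Qed.

Lemma ell2_coord_le (x : ell2 R) k : `|x k| <= `|x|.
Proof.
by rewrite -sqrtr_sqr; apply: ler_wsqrtr; apply: sqr_le_sqnorm (valP x).
Qed.

Lemma ell2_complete (F : set_system (ell2 R)) :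
  ProperFilter F -> cauchy F -> cvg F.
Proof.
move=> FF /cauchy_ballP Fc.
have Fsmall (e : R) : 0 < e ->
    exists2 A, F A & forall u v, A u -> A v -> `|u - v| < e.
  move=> e0; have [[A B] /= [FA FB] AB] := Fc _ e0.
  exists (A `&` B); first exact: filterI.
  move=> u v [Au _] [_ Bv]; have := AB (u, v) (conj Au Bv).
  by rewrite /= -ball_normE.
have ck k : cvg ((fun x : ell2 R => x k) @ F).
  apply: cauchy_cvg; apply/cauchy_ballP => e e0.
  have [A FA hA] := Fsmall _ e0.
  exists ([set x k | x in A], [set x k | x in A]) => /=.
    by split; apply: (@filterS _ F _ A) => // x Ax; exists x.
  move=> [_ _] [/= [u Au <-] [v Av <-]]; rewrite /= -ball_normE /=.
  exact: le_lt_trans (ell2_coord_le (u - v) k) (hA _ _ Au Av).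
pose l : R^nat := fun k => lim ((fun x : ell2 R => x k) @ F).
have close (e : R) A : 0 < e -> F A ->
    (forall u v, A u -> A v -> `|u - v| < e) -> forall u, A u ->
    (u : R^nat) - l \in square_summable /\ sqnorm ((u : R^nat) - l) <= e ^+ 2.
  move=> e0 FA hA u Au; apply: square_summable_le => N.
  have cN : (fun v : ell2 R => series (fun n => (u n - v n) ^+ 2) N) @ F -->
      series (fun n => (u n - l n) ^+ 2) N.
    elim: N => [|N IH].
      under eq_fun do rewrite seriesEnat /= big_geq//.
      by rewrite seriesEnat /= big_geq//; exact: cvg_cst.
    rewrite seriesSr.
    under eq_fun do rewrite seriesSr.
    apply: cvgD; first exact: IH.
    rewrite expr2; under eq_fun do rewrite expr2.
    by apply: cvgM; apply: cvgB; [exact: cvg_cst|exact: ck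
                                 |exact: cvg_cst|exact: ck].
  apply: (cvgr_to_le cN); apply: filterS FA => v Av.
  apply: le_trans (series_sq_le N (valP (u - v))) _.
  have <- : `|u - v| ^+ 2 = sqnorm (u - v).
    by rewrite ell2_normE sqr_sqrtr//; exact: sqnorm_ge0 (valP (u - v)).
  by rewrite lerXn2r ?nnegrE ?normr_ge0 ?ltW// hA.
have sl : l \in square_summable.
  have [A FA hA] := Fsmall _ ltr01.
  have [u Au] := filter_ex FA.
  have [h _] := close _ _ ltr01 FA hA _ Au.
  have -> : l = (u : R^nat) - ((u : R^nat) - l) by rewrite subKr.
  by rewrite rpredB// (valP u).
apply/cvg_ex; exists (Ell2 sl); apply/fcvgrPdist_lt => e e0.
have e20 : 0 < e / 2 by rewrite divr_gt0.
have [A FA hA] := Fsmall _ e20.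
have cA := close _ _ e20 FA hA.
apply: filterS FA => u Au; rewrite distrC.
have [_ h] := cA _ Au.
apply: (@le_lt_trans _ _ (e / 2)); last by lra.
rewrite -(ger0_norm (ltW e20)) -sqrtr_sqr; exact: ler_wsqrtr.
Qed.

HB.instance Definition _ := Uniform_isComplete.Build (ell2 R) ell2_complete.

End ell2_normed.

Section bases.
Context {R : realType} {X : completeNormedModType R}.

Definition schauder_basis (x : X^nat) : Prop :=
  forall v : X, exists! a : R^nat, series (fun n => a n *: x n) @ \oo --> v.

Definition coef (x : X^nat) : set (R^nat) :=
  [set a | cvgn (series (fun n => a n *: x n))].

Definition basis_equiv (x : X^nat) (a b : {ptws nat -> R}) : Prop :=
  coef x (a - b).

End bases.

Definition mod_ell2 {R : realType} (a b : {ptws nat -> R}) : Prop :=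
  a - b \in square_summable.

HB.instance Definition _ (I : Type) (T : I -> ptopologicalType) :=
  isPointed.Build (prod_topology T) (fun=> point).

(* [{ptws nat -> R}] carries the product topology, so it is the Polish space
   R^N; as a type it is [nat -> R], whence the pointwise difference above. *)

Section borel.
Context {Z W : ptopologicalType}.

(* The sigma-algebras are the Borel ones, generated by the open sets. *)
Definition borel_fun (f : Z -> W) : Prop :=
  measurable_fun [set: g_sigma_algebraType (@open Z)]
    (f : g_sigma_algebraType (@open Z) -> g_sigma_algebraType (@open W)).

Definition borel_reducible (E : Z -> Z -> Prop) (F : W -> W -> Prop) : Prop :=
  exists2 theta : Z -> W, borel_fun theta &
    forall x y, E x y <-> F (theta x) (theta y).

End borel.

Definition borel_bireducible {Z W : ptopologicalType}
    (E : Z -> Z -> Prop) (F : W -> W -> Prop) : Prop :=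
  borel_reducible E F /\ borel_reducible F E.

(* Main.v *)
Require Import Defs.
From HB Require Import structures.
From mathcomp Require Import all_boot all_order all_algebra.
From mathcomp Require Import all_classical all_reals all_analysis.
From mathcomp Require Import ring lra.
Import Order.TTheory GRing.Theory Num.Theory.
Import numFieldNormedType.Exports.

(** The coordinate functionals of a Schauder basis [y] of l2 are continuous, so
they are represented by vectors [g k] with [dot (g i) (y j) = (i == j)].
Applying Gram-Schmidt to the dual sequence [g], and not to [y] itself, gives an
orthonormal sequence [f] with [f j] in the span of [g 0], ..., [g j]; hence
[f j] is orthogonal to [y k] for [k > j] but not to [y j].  If [sum a_k y_k]
converges to [x], the [j]-th Fourier coefficient of [x] along [f] is therefore
the finite sum [sum_(k <= j) a_k (f_j | y_k)], which makes sense for every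
real sequence [a].  So the matrix [(f_j | y_k)] is lower triangular with
nonzero diagonal and acts as a linear homeomorphism of R^N, whose inverse is
computed by forward substitution (the lemmas [lower_mul_continuous] and
[lower_mul_section]).

This homeomorphism carries the coefficient space of [y] exactly onto l2
([coef_lower_mul]).  Coefficients of a convergent expansion go into l2 by
Bessel's inequality.  Conversely, if the image of [a] is in l2, the
Riesz-Fischer theorem gives [x] with these Fourier coefficients; the expansion
of [x] along [y] has the same image as [a], so it is [a] by injectivity.  The
homeomorphism and its inverse are thus the two reductions.

Continuity of the coordinate functionals ([schauder_basis_coord_bounded]) is
the one place where Baire's theorem enters, through Zabreiko's lemma
([countably_subadditive_seminorm_bounded]) for the seminorm
[sup_n |sum_(k < n) a_k y_k|], [a] being the coordinates of the point. *)

Set Implicit Arguments.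
Unset Strict Implicit.
Unset Printing Implicit Defensive.
Local Open Scope classical_set_scope.
Local Open Scope ring_scope.

(** * Countably subadditive seminorms on a Banach space *)

Lemma series0 (V : zmodType) (u : V^nat) : series u 0%N = 0.
Proof. by rewrite seriesEnat /= big_geq. Qed.

Lemma baire_closed_cover (R : realType) (X : completeNormedModType R)
    (A : (set X)^nat) : (forall x, exists n, A n x) ->
  exists n x r, 0 < r /\ ball x r `<=` closure (A n).
Proof.
move=> cover; apply: contrapT => noball.
have ODense n : open (~` closure (A n)) /\ dense (~` closure (A n)).
  split; first by apply: closed_openC; exact: closed_closure.
  move=> O [x Ox] oO; apply: contrapT => disj; apply: noball.
  have [r /= r0 xr] : exists2 r : R, 0 < r & ball x r `<=` O.
    by apply/nbhs_ballP; exact: open_nbhs_nbhs.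
  exists n, x, r; split=> // z /xr Oz; apply: contrapT => nz.
  by apply: disj; exists z.
have [z [_ zA]] := Baire ODense (ex_intro setT (0 : X) I) openT.
have [n An] := cover z.
by apply: (zA n I); exact: subset_closure.
Qed.

(** Zabreiko's lemma.  By Baire's theorem the closure of some sublevel set of
[p] contains a ball; taking differences and scaling, every [x] is then a limit
of points [u] with [p u <= K * `|x|].  Approximating [x], then the remainder,
and so on with errors halved each time, writes [x] as a series along which [p]
sums to at most [2 * K * `|x|]. *)
Lemma countably_subadditive_seminorm_bounded (R : realType)
    (X : completeNormedModType R) (p : X -> R) :
  (forall x z, p (x + z) <= p x + p z) ->
  (forall c x, p (c *: x) = `|c| * p x) ->
  (forall (u : X^nat) x M, series u @ \oo --> x ->
    (forall n, series (p \o u) n <= M) -> p x <= M) ->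
  exists C, forall x, p x <= C * `|x|.
Proof.
move=> pD pZ psum.
have p0 : p 0 = 0 by rewrite -(scale0r (0 : X)) pZ normr0 mul0r.
have pN x : p (- x) = p x by rewrite -scaleN1r pZ normrN1 mul1r.
have p_ge0 x : 0 <= p x.
  by have := pD x (- x); rewrite subrr p0 pN; lra.
have cover x : exists n, [set z | p z <= n%:R] x.
  by exists (Num.truncn (p x)).+1 => /=; exact/ltW/truncnS_gt.
have [M [x0 [r [r0 ballM]]]] := baire_closed_cover cover.
have near_sublevel z e : closure [set z | p z <= M%:R] z -> 0 < e ->
    exists2 u, p u <= M%:R & `|z - u| < e.
  move=> Mz e0; have [u [pu]] := Mz _ (nbhsx_ballx z e e0).
  by rewrite -ball_normE; exists u.
pose K := 4 * M%:R / r.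
have K0 : 0 <= K by rewrite divr_ge0 ?mulr_ge0// ltW.
have approx x e : 0 < e -> exists2 u, p u <= K * `|x| & `|x - u| < e.
  move=> e0; have [->|xn0] := eqVneq x 0.
    by exists 0; rewrite ?p0 ?normr0 ?mulr0// subr0 normr0.
  have nx0 : 0 < `|x| by rewrite normr_gt0.
  (* [t *: x] has norm [r / 2]; it is close to a difference of two points of the
  sublevel set, where [p] is at most [2 * M], and dividing by [t] gives [K]. *)
  pose t := r / (2 * `|x|).
  have t0 : 0 < t by rewrite divr_gt0// mulr_gt0.
  have tx : ball x0 r (x0 + t *: x).
    rewrite -ball_normE /= opprD addNKr normrN normrZ gtr0_norm//.
    by rewrite (_ : t * `|x| = r / 2) ?/t; [lra|field; rewrite gt_eqF].
  have te0 : 0 < t * e / 2 by rewrite divr_gt0// mulr_gt0.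
  have [u pu xu] := near_sublevel _ _ (ballM _ tx) te0.
  have [v pv xv] := near_sublevel _ _ (ballM _ (ballxx x0 r0)) te0.
  exists (t^-1 *: (u - v)).
    rewrite pZ gtr0_norm ?invr_gt0// mulrC ler_pdivrMr//.
    rewrite (_ : K * `|x| * t = M%:R + M%:R); last first.
      by rewrite /K /t; field; rewrite !gt_eqF.
    by apply: (le_trans (pD _ _)); rewrite pN lerD.
  rewrite -(ltr_pM2l t0) -{1}(gtr0_norm t0) -normrZ scalerBr scalerA.
  rewrite mulfV ?gt_eqF// scale1r.
  have -> : t *: x - (u - v) = (x0 + t *: x - u) - (x0 - v).
    by rewrite -[x0 + _ - u]addrA [RHS]addrC !opprB addrA subrK addrCA.
  by rewrite (le_lt_trans (ler_normB _ _))//; lra.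
exists (2 * K) => x; have [->|xn0] := eqVneq x 0.
  by rewrite p0 normr0 mulr0.
have nx0 : 0 < `|x| by rewrite normr_gt0.
have half_gt0 n : 0 < `|x| / 2 ^+ n by rewrite divr_gt0// exprn_gt0.
have [g gP] : {g : X * nat -> X & forall zn : X * nat,
    p (g zn) <= K * `|zn.1| /\ `|zn.1 - g zn| < `|x| / 2 ^+ zn.2.+1}.
  apply: (choice (P := fun zn u => p u <= K * `|zn.1| /\
    `|zn.1 - u| < `|x| / 2 ^+ zn.2.+1)) => zn.
  by have [u] := approx zn.1 _ (half_gt0 zn.2.+1); exists u.
(* [z n] is the remainder after [n] approximations. *)
pose z := fix z n := if n is m.+1 then z m - g (z m, m) else x.
pose u n := g (z n, n).
have zE n : series u n = x - z n.
  elim: n => [|n IH]; first by rewrite series0 subrr.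
  by rewrite seriesSr IH /= opprB addrA addrAC.
have z_le n : `|z n| <= `|x| / 2 ^+ n.
  by case: n => [|n]; [rewrite expr0 divr1|exact/ltW/(gP (z n, n)).2].
have pu n : p (u n) <= K * (`|x| / 2 ^+ n).
  by apply: (le_trans (gP (z n, n)).1); rewrite ler_wpM2l// z_le.
have geo n : series (p \o u) n <= K * (2 * `|x| - 2 * (`|x| / 2 ^+ n)).
  elim: n => [|n IH].
    by rewrite series0 expr0 divr1 subrr mulr0.
  rewrite seriesSr; apply: le_trans (lerD IH (pu n)) _.
  rewrite -mulrDr ler_wpM2l// exprS.
  rewrite (_ : `|x| / (2 * 2 ^+ n) = `|x| / 2 ^+ n / 2); last first.
    by field; rewrite expf_neq0.
  by lra.
apply: (psum u) => [|n]; last first.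
  apply: le_trans (geo n) _; rewrite -[leRHS]mulrA [leRHS]mulrCA.
  rewrite ler_wpM2l// gerDl oppr_le0.
  by rewrite mulr_ge0// ltW.
rewrite (_ : series u = (fun n => x - z n)); last by apply/funext.
rewrite -[X in _ --> X]subr0; apply: cvgB; first exact: cvg_cst.
apply/norm_cvg0P.
apply: (@squeeze_cvgr _ _ _ _ (cst 0) (fun n => `|x| / 2 ^+ n)).
- by apply: nearW => n; rewrite normr_ge0 /=.
- exact: cvg_cst.
- rewrite (_ : (fun _ => _) = geometric `|x| 2^-1); last first.
    by apply/funext => n; rewrite /= exprVn.
  by apply: cvg_geometric; rewrite ger0_norm ?invr_ge0// invf_lt1// ltr1n.
Qed.

(** * Continuity of the coordinate functionals of a Schauder basis *)

Definition expansion (R : realType) (X : completeNormedModType R) (y : X^nat)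
    (a : R^nat) : X^nat := series (fun n => a n *: y n).

Section expansion.
Context {R : realType} {X : completeNormedModType R}.
Implicit Types (y : X^nat) (a b : R^nat).

Lemma expansionD y a b : expansion y (a + b) = expansion y a + expansion y b.
Proof.
rewrite /expansion -seriesD; congr series; apply/funext => n.
by rewrite !fctE scalerDl.
Qed.

Lemma expansionZ y k a : expansion y (k *: a) = k *: expansion y a.
Proof.
rewrite /expansion -seriesZ; congr series; apply/funext => n.
by rewrite !fctE scalerA.
Qed.

Lemma expansionB y a b : expansion y (a - b) = expansion y a - expansion y b.
Proof. by rewrite -scaleN1r expansionD expansionZ scaleN1r. Qed.

Lemma expansion_cvg y (a : nat -> R^nat) b n :
  (forall k, a m k @[m --> \oo] --> b k) ->
  expansion y (a m) n @[m --> \oo] --> expansion y b n.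
Proof.
move=> ab; elim: n => [|n IH].
  rewrite /expansion; under eq_fun do rewrite series0.
  by rewrite series0; exact: cvg_cst.
rewrite /expansion seriesSr; under eq_fun do rewrite seriesSr.
by apply: cvgD; [exact: IH|exact: cvgZr_tmp].
Qed.

Lemma expansion_delta_cvg y k :
  expansion y (fun n => (n == k)%:R) @ \oo --> y k.
Proof.
apply: cvg_near_cst; near=> n.
have kn : (k < n)%N by near: n; exact: nbhs_infty_gt.
rewrite /expansion seriesEord /= (bigD1 (Ordinal kn))//= eqxx scale1r.
rewrite big1 ?addr0// => i.
by rewrite -val_eqE => /negbTE /= ->; rewrite scale0r.
Unshelve. all: by end_near. Qed.

Lemma schauder_basis_coord y : schauder_basis y -> exists c : X -> R^nat,
  [/\ forall x, expansion y (c x) @ \oo --> x,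
      forall x a, expansion y a @ \oo --> x -> c x = a
    & linear c].
Proof.
move=> hy.
have [c cP] : {c : X -> R^nat & forall x, expansion y (c x) @ \oo --> x}.
  apply: (choice (P := fun x a => expansion y a @ \oo --> x)) => x.
  by have [a [ax _]] := hy x; exists a.
have cU x a : expansion y a @ \oo --> x -> c x = a.
  move=> ax; have [b [_ bU]] := hy x.
  by rewrite -(bU _ ax) -(bU _ (cP x)).
exists c; split=> // t x z; apply: cU; rewrite expansionD expansionZ.
by apply: cvgD => //; exact: cvgZl_tmp.
Qed.

Lemma schauder_basis_neq0 y : schauder_basis y -> forall k, y k != 0.
Proof.
move=> /schauder_basis_coord[c [_ cU cL]] k; apply/eqP => yk0.
have c0 : c 0 = 0 by have := cL (- 1) 0 0; rewrite scaler0 addr0 scaleN1r addNr.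
have := @expansion_delta_cvg y k; rewrite yk0 => /cU /(congr1 (@^~ k)).
by rewrite c0 eqxx => /esym/eqP; rewrite oner_eq0.
Qed.

(** The seminorm [p x], the supremum of the norms of the partial sums of the
expansion of [x], dominates each coordinate.  It is countably subadditive: if
[p] is summable along a series converging to [x], the coordinates of its terms
sum, coordinate by coordinate, to some [a], whose partial sums are uniformly
approximated by those of the finite sums; hence [a] expands [x], so [a] gives
the coordinates of [x] by uniqueness. *)
Lemma schauder_basis_coord_bounded y : schauder_basis y ->
  forall k, exists C, forall a (x : X), expansion y a @ \oo --> x ->
    `|a k| <= C * `|x|.
Proof.
move=> hy k0; have y0 := schauder_basis_neq0 hy.
have [c [cP cU cL]] := schauder_basis_coord hy.
have cD x z : c (x + z) = c x + c z by rewrite -{1}(scale1r x) cL scale1r.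
have c0 : c 0 = 0 by have := cD 0 0; rewrite addr0 -{1}[c 0]addr0 => /addrI.
have cZ t x : c (t *: x) = t *: c x by rewrite -[t *: x]addr0 cL c0 addr0.
have cB x z : c (x - z) = c x - c z by rewrite -scaleN1r cD cZ scaleN1r.
pose p x := sup (range (fun n => `|expansion y (c x) n|)).
have p_ub x n : `|expansion y (c x) n| <= p x.
  apply: ub_le_sup; last by exists n.
  have /cvgP/cvg_seq_bounded/pinfty_ex_gt0[M _ /= HM] := cP x.
  by exists M => _ [m _ <-]; exact: HM.
have p_le x M : (forall n, `|expansion y (c x) n| <= M) -> p x <= M.
  move=> HM; apply: ge_sup => [|_ [n _ <-]//].
  by exists `|expansion y (c x) 0%N|, 0%N.
have p_ge0 x : 0 <= p x by apply: le_trans (p_ub x 0%N).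
have pD x z : p (x + z) <= p x + p z.
  apply: p_le => n; rewrite cD expansionD.
  by apply: le_trans (ler_normD _ _) _; exact: lerD.
have pZ_le t x : p (t *: x) <= `|t| * p x.
  by apply: p_le => n; rewrite cZ expansionZ normrZ ler_wpM2l.
have pZ t x : p (t *: x) = `|t| * p x.
  apply/eqP; rewrite eq_le pZ_le /=; have [->|t0] := eqVneq t 0.
    by rewrite normr0 mul0r.
  rewrite -ler_pdivlMl ?normr_gt0// -normfV.
  by apply: le_trans (pZ_le _ _); rewrite scalerA mulVf// scale1r.
have coord_le k x : `|c x k| <= 2 * p x / `|y k|.
  rewrite ler_pdivlMr ?normr_gt0// -normrZ.
  rewrite -(seriesSB (fun n => c x n *: y n)) mulr_natl mulr2n.
  by apply: le_trans (ler_normB _ _) _; apply: lerD; exact: p_ub.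
have [C pC] : exists C, forall x, p x <= C * `|x|.
  apply: countably_subadditive_seminorm_bounded => // u x M ux uM.
  pose P := limn (series (p \o u)).
  have nd_pu : nondecreasing_seq (series (p \o u)).
    by apply: nondecreasing_series => n _ _; exact: p_ge0.
  have cvg_pu : cvgn (series (p \o u)).
    by apply: nondecreasing_is_cvgn => //; exists M => _ [n _ <-].
  have pu_le n : series (p \o u) n <= P by exact: nondecreasing_cvgn_le.
  have PM : P <= M by apply: limr_le => //; exact: nearW.
  have cw k m : c (series u m) k = series (fun i => c (u i) k) m.
    elim: m => [|m IH]; first by rewrite !series0 c0.
    by rewrite !seriesSr cD -IH.
  pose a k := limn (series (fun i => c (u i) k)).
  have cwa k : c (series u m) k @[m --> \oo] --> a k.
    under eq_fun do rewrite cw.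
    apply: normed_cvg; apply: (@series_le_cvg _ _ (2 / `|y k| *: (p \o u))).
    - by move=> n; exact: normr_ge0.
    - by move=> n; rewrite !fctE mulr_ge0// divr_ge0.
    - by move=> n; rewrite !fctE [_ *: _]mulrAC; exact: coord_le.
    - exact: is_cvg_seriesZ.
  have pw m l : (m <= l)%N ->
      p (series u l - series u m) <= series (p \o u) l - series (p \o u) m.
    move=> ml; rewrite !sub_series_geq//.
    elim/big_ind2 : _ => // [|x1 x2 z1 z2 h1 h2].
      by rewrite -(scale0r (0 : X)) pZ normr0 mul0r.
    by apply: le_trans (pD _ _) _; exact: lerD.
  have aw m n : `|expansion y a n - expansion y (c (series u m)) n| <=
      P - series (p \o u) m.
    apply: (@cvgr_to_le _ \oo _ _
      (fun l => `|expansion y (c (series u l)) n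
                  - expansion y (c (series u m)) n|)).
      apply: cvg_norm; apply: cvgB; last exact: cvg_cst.
      exact: expansion_cvg.
    near=> l; have ml : (m <= l)%N by near: l; exact: nbhs_infty_ge.
    rewrite -[X in `|X|]/((expansion y _ - expansion y _) n) -expansionB -cB.
    apply: (le_trans (p_ub _ _)); apply: (le_trans (pw _ _ ml)).
    by rewrite lerD2r.
  have ax : expansion y a @ \oo --> x.
    apply/cvgrPdist_lt => e e0; have e30 : 0 < e / 3 by rewrite divr_gt0.
    have /cvgrPdist_lt/(_ _ e30) puP : series (p \o u) @ \oo --> P by [].
    move/cvgrPdist_lt/(_ _ e30) : ux => ux.
    have [m [/= pum um]] := filter_ex (filterI puP ux).
    have /cvgrPdist_lt/(_ _ e30) := cP (series u m).
    apply: filterS => n wn; have awn := aw m n.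
    have {}pum : P - series (p \o u) m < e / 3.
      by rewrite (le_lt_trans _ pum)// ler_norm.
    have h1 := ler_distD (series u m) x (expansion y a n).
    have h2 := ler_distD (expansion y (c (series u m)) n) (series u m)
      (expansion y a n).
    by rewrite (distrC (expansion y (c _) n)) in h2; move: um wn; lra.
  (* [aw 0 n] bounds the whole partial sum, as [series u 0 = 0]. *)
  apply: p_le => n; rewrite (cU x a ax).
  have := aw 0%N n; rewrite !series0.
  rewrite c0 -{1}(scale0r 0) expansionZ scale0r !subr0.
  by move/le_trans; apply.
exists (2 * C / `|y k0|) => a x /cU <-.
apply: le_trans (coord_le _ _) _.
rewrite [leRHS]mulrAC ler_wpM2r ?invr_ge0// -mulrA ler_wpM2l//.
Unshelve. all: by end_near. Qed.
End expansion.

(** * The inner product of l2 and orthonormal sequences *)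

Section ell2_dot.
Context {R : realType}.
Implicit Types x z : ell2 R.

(** The series converges for all [x] and [z] by [is_cvg_dot]. *)
Definition dot x z : R := limn (series (fun n => x n * z n)).

Lemma is_cvg_dot x z : cvgn (series (fun n => x n * z n)).
Proof.
have cvg_sq (u : ell2 R) : cvgn (series (fun n => u n ^+ 2)).
  by have := valP u; rewrite inE.
rewrite (_ : (fun n => _) = 4^-1 *:
  ((fun n => (x + z) n ^+ 2) - (fun n => (x - z) n ^+ 2))).
  by apply: is_cvg_seriesZ; apply: is_cvg_seriesB.
apply/funext => n; rewrite !fctE -[(x + z) n]/(x n + z n).
by rewrite -[(x - z) n]/(x n - z n) -[_ *: _]/(_ * _); field.
Qed.

Lemma dotC x z : dot x z = dot z x.
Proof. by rewrite /dot; under eq_fun do rewrite mulrC. Qed.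

Lemma dotxx x : dot x x = `|x| ^+ 2.
Proof.
rewrite ell2_normE sqr_sqrtr; last exact: sqnorm_ge0 (valP x).
by rewrite /dot; under eq_fun do rewrite -expr2.
Qed.

Fact dot_is_scalar x : scalar (dot x).
Proof.
move=> c u v; rewrite /dot.
rewrite (_ : (fun n => _) = c *: (fun n => x n * u n) + (fun n => x n * v n)).
  have cu := @is_cvg_dot x u; have cv := @is_cvg_dot x v.
  by rewrite lim_seriesD; [rewrite lim_seriesZ|exact: is_cvg_seriesZ|].
apply/funext => n; rewrite !fctE -[(c *: u + v) n]/(c * u n + v n).
by rewrite -[_ *: _]/(_ * _); ring.
Qed.

HB.instance Definition _ x :=
  GRing.isLinear.Build R (ell2 R) R *%R (dot x) (dot_is_scalar x).

Lemma sqr_normB x z : `|x - z| ^+ 2 = `|x| ^+ 2 - 2 * dot x z + `|z| ^+ 2.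
Proof.
rewrite -!dotxx linearB /= ![dot (x - z) _]dotC !linearB /= (dotC z x); ring.
Qed.

Lemma dot_le x z : `|dot x z| <= `|x| * `|z|.
Proof.
have [->|x0] := eqVneq x 0; first by rewrite dotC linear0 !normr0 mul0r.
have [->|z0] := eqVneq z 0; first by rewrite linear0 !normr0 mulr0.
have xz0 : 0 < `|x| * `|z| by rewrite mulr_gt0 ?normr_gt0.
have dot_le u v : `|u| * `|v| = `|x| * `|z| -> dot u v <= `|x| * `|z|.
  have dotZ : dot (`|v| *: u) (`|u| *: v) = `|u| * `|v| * dot u v.
    by rewrite linearZ /= dotC linearZ /= dotC mulrA.
  move=> uv; have := sqr_ge0 `| `|v| *: u - `|u| *: v|.
  rewrite sqr_normB dotZ !normrZ !normr_id (mulrC `|v|) uv => h.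
  by rewrite -(ler_pM2l xz0); lra.
rewrite ler_norml dot_le// andbT -lerNl -linearN dot_le// normrN//.
Qed.

Lemma dot_cvg x (u : nat -> ell2 R) l : u @ \oo --> l ->
  dot x (u n) @[n --> \oo] --> dot x l.
Proof.
move=> ul; apply/cvgrPdist_lt => e e0.
have x0 : 0 < `|x| + 1 by rewrite ltr_wpDl.
have /cvgrPdist_lt/(_ _ (divr_gt0 e0 x0)) := ul.
apply: filterS => n; rewrite ltr_pdivlMr// -linearB => h.
apply: (le_lt_trans (dot_le _ _)); apply: le_lt_trans h.
by rewrite mulrC ler_wpM2l// lerDl.
Qed.

Definition orthonormal (f : nat -> ell2 R) : Prop :=
  forall i j, dot (f i) (f j) = (i == j)%:R.

Lemma orthonormal_dot_sum f (c : R^nat) j m n : orthonormal f ->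
  dot (f j) (\sum_(m <= k < n) c k *: f k) = if (m <= j < n)%N then c j else 0.
Proof.
move=> fo; rewrite linear_sum /=; under eq_bigr do rewrite linearZ /= fo.
case: ifPn => [jmn|jmn].
  rewrite (bigD1_seq j) ?iota_uniq ?mem_index_iota//= eqxx mulr1 big1 ?addr0//.
  by move=> i /negbTE; rewrite eq_sym => ->; rewrite mulr0.
rewrite big_nat_cond big1// => i /andP[imn _].
by case: eqVneq imn jmn => [->->//|_]; rewrite mulr0.
Qed.

Lemma orthonormal_sqr_norm_sum f (c : R^nat) m n : orthonormal f ->
  `|\sum_(m <= k < n) c k *: f k| ^+ 2 = \sum_(m <= k < n) c k ^+ 2.
Proof.
move=> fo; rewrite -dotxx linear_sum /=; apply: eq_big_nat => i imn.
by rewrite linearZ /= dotC orthonormal_dot_sum// imn expr2.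
Qed.

Lemma bessel f x : orthonormal f -> (fun k => dot (f k) x) \in square_summable.
Proof.
move=> fo; apply: (proj1 (@square_summable_le _ _ (`|x| ^+ 2) _)) => n.
rewrite seriesEnat /=; set s := \sum_(0 <= k < n) dot (f k) x *: f k.
have ds : dot x s = \sum_(0 <= k < n) dot (f k) x ^+ 2.
  by rewrite linear_sum; apply: eq_bigr => k _; rewrite linearZ /= dotC.
have := sqr_ge0 `|x - s|.
by rewrite sqr_normB ds orthonormal_sqr_norm_sum//; lra.
Qed.

Lemma riesz_fischer f (c : R^nat) : orthonormal f -> c \in square_summable ->
  exists x, expansion f c @ \oo --> x /\ forall j, dot (f j) x = c j.
Proof.
rewrite inE => fo /cauchy_cvgP/cauchy_seriesP cc.
have /cvg_ex[x cx] : cvgn (expansion f c).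
  apply/cauchy_cvgP/cauchy_seriesP => e e0.
  apply: filterS (cc _ (exprn_gt0 2 e0)) => -[m n] /=.
  rewrite ger0_norm ?sumr_ge0// => [|i _]; last exact: sqr_ge0.
  by rewrite -(orthonormal_sqr_norm_sum _ _ _ fo) ltr_pXn2r ?nnegrE ?(ltW e0).
exists x; split=> // j.
rewrite -(cvg_lim (@Rhausdorff R) (@dot_cvg (f j) _ _ cx)).
apply: cvg_lim; first by exact: Rhausdorff.
apply: cvg_near_cst; near=> n; rewrite /expansion seriesEnat /=.
by rewrite orthonormal_dot_sum//= ifT//; near: n; exact: nbhs_infty_gt.
Unshelve. all: by end_near. Qed.

(** The Riesz representation theorem for l2: the representing sequence is made
of the values of [phi] on the unit vectors, and it is square summable because
[phi] maps the vector [s] of its first [n] terms to [`|s| ^+ 2], which is at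
most [C * `|s|]. *)
Lemma riesz_ell2 (phi : ell2 R -> R) C : scalar phi ->
  (forall x, `|phi x| <= C * `|x|) -> exists g, forall x, phi x = dot g x.
Proof.
move=> phiL phiC.
pose F : {scalar ell2 R} :=
  HB.pack phi (GRing.isLinear.Build R (ell2 R) R *%R phi phiL).
have phi_sum (c : R^nat) (u : nat -> ell2 R) n :
    phi (expansion u c n) = series (fun k => c k * phi (u k)) n.
  rewrite -[phi]/(F : _ -> _) linear_sum; apply: eq_bigr => i _; exact: linearZ.
have delta_summable k : (fun n => (n == k)%:R : R) \in square_summable.
  apply: (proj1 (@square_summable_le _ _ 1 _)) => n; rewrite seriesEord /=.
  have [kn|nk] := ltnP k n; last first.
    rewrite big1// => i _; rewrite (_ : (i : nat) == k = false) ?expr0n//.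
    by apply: contraTF nk => /eqP <-; rewrite -ltnNge.
  rewrite (bigD1 (Ordinal kn))//= eqxx expr1n big1 ?addr0// => i.
  by rewrite -val_eqE => /negbTE /= ->; rewrite expr0n.
pose e k := Ell2 (delta_summable k).
have dote k x : dot (e k) x = x k.
  have cvg_xk : series (fun n => e k n * x n) @ \oo --> x k.
    apply: cvg_near_cst; near=> n.
    have kn : (k < n)%N by near: n; exact: nbhs_infty_gt.
    rewrite seriesEord /= (bigD1 (Ordinal kn))//= eqxx mul1r big1 ?addr0// => i.
    by rewrite -val_eqE => /negbTE /= ->; rewrite mul0r.
  by apply: cvg_lim cvg_xk; exact: Rhausdorff.
have eo : orthonormal e by move=> i j; rewrite dote.
have g_summable : (fun k => phi (e k)) \in square_summable.
  apply: (proj1 (@square_summable_le _ _ (C ^+ 2) _)) => n.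
  set s := expansion e (fun k => phi (e k)) n.
  have s2 : `|s| ^+ 2 = series (fun k => phi (e k) ^+ 2) n.
    by rewrite orthonormal_sqr_norm_sum.
  have phis : phi s = `|s| ^+ 2.
    by rewrite phi_sum s2; congr series; apply/funext => k; rewrite expr2.
  rewrite -s2; have [->|s0] := eqVneq `|s| 0; first by rewrite expr0n sqr_ge0.
  have sC : `|s| <= C.
    rewrite -(@ler_pM2r _ `|s|) ?lt_def ?s0//=; apply: le_trans (phiC s).
    by rewrite phis expr2 ler_norm.
  by rewrite ler_pXn2r ?nnegrE// (le_trans _ sC).
exists (Ell2 g_summable) => x.
have [z [xz dz]] := riesz_fischer eo (valP x).
have zx : z = x by apply/val_inj/funext => j; rewrite -[LHS]dote dz.
have phi_cvg : phi (expansion e x n) @[n --> \oo] --> phi x.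
  apply/cvgrPdist_lt => d d0; have C0 : 0 < `|C| + 1 by rewrite ltr_wpDl.
  move: xz; rewrite zx => /cvgrPdist_lt/(_ _ (divr_gt0 d0 C0)).
  apply: filterS => n; rewrite ltr_pdivlMr// => h.
  rewrite -[phi]/(F : _ -> _) -linearB; apply: le_lt_trans (phiC _) _.
  apply: le_lt_trans h; rewrite mulrC ler_wpM2l// (le_trans (ler_norm C))//.
  by rewrite lerDl.
rewrite -(cvg_lim (@Rhausdorff R) phi_cvg); apply: cvg_lim.
  exact: Rhausdorff.
under eq_fun do rewrite phi_sum.
rewrite dotC; exact: is_cvg_dot.
Unshelve. all: by end_near. Qed.
End ell2_dot.

(** * Gram-Schmidt on a biorthogonal sequence *)

(** Course-of-values recursion, in the form used both for Gram-Schmidt and for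
forward substitution. *)
Lemma strong_recursion (T : Type) (F : seq T -> T) :
  exists u : nat -> T, forall n, u n = F (mkseq u n).
Proof.
pose s := fix s n := if n is m.+1 then rcons (s m) (F (s m)) else [::].
exists (F \o s) => n /=; congr F.
by elim: n => //= n IH; rewrite mkseqS /= -IH.
Qed.

(** [f i] is a combination of [g 0], ..., [g i], all orthogonal to the later
[y j].  The process never meets the zero vector: the unnormalized [h i] differs
from [g i] by vectors orthogonal to [y i], so it pairs to 1 with [y i]. *)
Lemma gram_schmidt_biorthogonal (R : realType) (g y : nat -> ell2 R) :
  (forall i j, dot (g i) (y j) = (i == j)%:R) ->
  exists f, [/\ orthonormal f,
    forall i j, (i < j)%N -> dot (f i) (y j) = 0
  & forall i, dot (f i) (y i) != 0].
Proof.
move=> gy.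
have [f fE] := strong_recursion (fun s : seq (ell2 R) =>
  let h := g (size s) - \sum_(v <- s) dot v (g (size s)) *: v in
  `|h|^-1 *: h).
pose h n := g n - \sum_(0 <= i < n) dot (f i) (g n) *: f i.
have {}fE n : f n = `|h n|^-1 *: h n.
  by rewrite {1}fE size_mkseq big_map /h /index_iota subn0.
have dot_f x n : dot x (f n) = `|h n|^-1 * dot x (h n).
  by rewrite fE linearZ.
have dot_h x n : dot x (h n) =
    dot x (g n) - \sum_(0 <= i < n) dot (f i) (g n) * dot x (f i).
  rewrite linearB linear_sum; congr (_ - _).
  by apply: eq_bigr => i _; rewrite linearZ.
have fy i j : (i < j)%N -> dot (f i) (y j) = 0.
  elim/ltn_ind: i => i IH ij; rewrite dotC dot_f dot_h dotC gy.
  rewrite big_nat big1 ?(ltn_eqF ij) ?subr0 ?mulr0// => k /= ki.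
  by rewrite (dotC (y j)) IH ?mulr0// (ltn_trans ki).
have hy n : dot (y n) (h n) = 1.
  rewrite dot_h dotC gy eqxx big_nat big1 ?subr0// => k /= kn.
  by rewrite (dotC (y n)) fy ?mulr0.
have h0 n : `|h n| != 0.
  rewrite normr_eq0; apply: contra_eq_neq (hy n) => ->.
  by rewrite linear0 eq_sym oner_neq0.
have fo n : forall i j, (i < n)%N -> (j < n)%N -> dot (f i) (f j) = (i == j)%:R.
  elim: n => // n IH.
  have fn i : (i < n)%N -> dot (f i) (f n) = 0.
    move=> ni; rewrite dot_f dot_h (bigD1_seq i) ?iota_uniq ?mem_index_iota//=.
    rewrite IH// eqxx mulr1 big_nat_cond big1 ?addr0 ?subrr ?mulr0// => k.
    by case/andP => /= kn ki; rewrite IH// eq_sym (negbTE ki) mulr0.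
  move=> i j; rewrite !ltnS leq_eqVlt => /orP[/eqP->|ni];
    rewrite leq_eqVlt => /orP[/eqP->|nj].
  - by rewrite dotxx fE normrZ normfV normr_id mulVf// expr1n eqxx.
  - by rewrite dotC fn// gtn_eqF.
  - by rewrite fn// ltn_eqF.
  - exact: IH.
exists f; split=> // [i j|i].
  by apply: (fo (maxn i j).+1); rewrite ltnS ?leq_maxl ?leq_maxr.
by rewrite dotC dot_f hy mulr1 invr_eq0.
Qed.

(** * Lower triangular maps of R^N *)

Section lower_triangular.
Context {R : realType}.
Implicit Types (L : nat -> nat -> R) (a b c : {ptws nat -> R}).

Definition lower_mul L a : {ptws nat -> R} :=
  fun j => \sum_(0 <= k < j.+1) a k * L j k.

Lemma lower_mulB L a b : lower_mul L (a - b) = lower_mul L a - lower_mul L b.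
Proof.
apply/funext => j; rewrite /lower_mul !fctE -sumrB.
by apply: eq_bigr => k _; rewrite mulrBl.
Qed.

Lemma continuous_coord k : continuous (fun a => a k : R).
Proof. exact: (@proj_continuous nat (fun=> R) k). Qed.

Lemma continuous_ptws (Z : topologicalType) (F : Z -> {ptws nat -> R}) :
  (forall k, continuous (fun z => F z k)) -> continuous F.
Proof. by move=> cF z; apply/pointwise_cvgP => k; exact: cF. Qed.

Lemma continuous_lin_sum (Z : topologicalType) (u : nat -> Z -> R)
    (l : nat -> R) n :
  (forall k, (k < n)%N -> continuous (u k)) ->
  continuous (fun z => \sum_(0 <= k < n) u k z * l k).
Proof.
elim: n => [|n IH] uc z; rewrite /continuous_at.
  under eq_fun do rewrite big_geq//.
  by rewrite big_geq//; exact: cvg_cst.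
under eq_fun do rewrite big_nat_recr//=.
rewrite big_nat_recr//=.
apply: cvgD; first by apply: IH => k kn; apply: uc; exact: ltnW.
by apply: cvgM; [exact: uc|exact: cvg_cst].
Qed.

Lemma continuous_substitution (Z : topologicalType) (v : Z -> R)
    (u : nat -> Z -> R) (l : nat -> R) (d : R) n :
  continuous v -> (forall k, (k < n)%N -> continuous (u k)) ->
  continuous (fun z => (v z - \sum_(0 <= k < n) u k z * l k) / d).
Proof.
move=> cv cu z; apply: cvgM; last exact: cvg_cst.
by apply: cvgB; [exact: cv|exact: continuous_lin_sum].
Qed.

Lemma lower_mul_continuous L : continuous (lower_mul L).
Proof.
apply: continuous_ptws => j; apply: continuous_lin_sum => k _.
exact: continuous_coord.
Qed.

Lemma lower_mul_inj L : (forall j, L j j != 0) -> injective (lower_mul L).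
Proof.
move=> L0 a b ab; apply/funext => j; elim/ltn_ind: j => j IH.
have := congr1 (@^~ j) ab; rewrite /lower_mul !big_nat_recr//=.
rewrite (eq_big_nat _ _ (F2 := fun k => b k * L j k)) => [/addrI|k /= kj].
  exact: mulIf.
by rewrite IH.
Qed.

(** Forward substitution: each unknown is a continuous function of the
right-hand side and of the earlier unknowns. *)
Lemma lower_mul_section L : (forall j, L j j != 0) ->
  exists2 eta, continuous eta & cancel eta (lower_mul L).
Proof.
move=> L0; have [u uE] := strong_recursion
  (fun (s : seq ({ptws nat -> R} -> R)) c =>
  let j := size s in
  (c j - \sum_(0 <= k < j) nth (fun=> 0) s k c * L j k) / L j j).
have {}uE j c : u j c = (c j - \sum_(0 <= k < j) u k c * L j k) / L j j.
  rewrite {1}uE size_mkseq; congr ((_ - _) / _).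
  by apply: eq_big_nat => k /= kj; rewrite nth_mkseq.
have u_cont j : continuous (u j).
  elim/ltn_ind: j => j IH.
  have -> : u j = fun c => (c j - \sum_(0 <= k < j) u k c * L j k) / L j j.
    exact/funext/uE.
  exact: (continuous_substitution (continuous_coord (k := j))).
exists (fun c j => u j c); first exact: continuous_ptws.
move=> c; apply/funext => j; rewrite /lower_mul big_nat_recr//= uE.
by rewrite mulfVK// addrC subrK.
Qed.

End lower_triangular.

(** * The two reductions *)

Lemma continuous_borel_fun (Z W : ptopologicalType) (F : Z -> W) :
  continuous F -> borel_fun F.
Proof.
move=> /continuousP cF.
apply: (@measurability _ _ (g_sigma_algebraType (@open Z))
  (g_sigma_algebraType (@open W)) setT F (@open W)) => //.
move=> _ [U oU <-]; rewrite setTI; apply: sub_sigma_algebra; exact: cF.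
Qed.

Lemma basis_biorthogonal (R : realType) (y : nat -> ell2 R) :
  schauder_basis y ->
  exists g, forall k a x, expansion y a @ \oo --> x -> dot (g k) x = a k.
Proof.
move=> hy; have [c [cP cU cL]] := schauder_basis_coord hy.
have [g gP] : {g : nat -> ell2 R & forall k x, c x k = dot (g k) x}.
  apply: (choice (P := fun k v => forall x, c x k = dot v x)) => k.
  have [C yC] := schauder_basis_coord_bounded hy k.
  apply: (@riesz_ell2 _ (fun x => c x k) C) => [t u v|x].
    by rewrite cL.
  exact: yC.
by exists g => k a x /cU <-; rewrite gP.
Qed.

(** The entry [L j k] is [dot (f j) (y k)] for the orthonormal sequence [f] of
[gram_schmidt_biorthogonal]; the vanishing of the entries with [k > j] is what
makes Fourier coefficients along [f] finite sums in the coordinates along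
[y]. *)
Lemma coef_lower_mul (R : realType) (y : nat -> ell2 R) : schauder_basis y ->
  exists2 L : nat -> nat -> R, forall j, L j j != 0 &
    forall a, coef y a <-> lower_mul L a \in square_summable.
Proof.
move=> hy; have [g gP] := basis_biorthogonal hy.
have gy i j : dot (g i) (y j) = (i == j)%:R.
  by rewrite (gP _ _ _ (@expansion_delta_cvg _ _ y j)).
have [f [fo fy0 fy]] := gram_schmidt_biorthogonal gy.
pose L j k := dot (f j) (y k).
have dotL a x j : expansion y a @ \oo --> x -> dot (f j) x = lower_mul L a j.
  move=> ax; rewrite -(cvg_lim (@Rhausdorff R) (@dot_cvg _ (f j) _ _ ax)).
  apply: cvg_lim; first by exact: Rhausdorff.
  apply: cvg_near_cst; near=> n.
  have jn : (j < n)%N by near: n; exact: nbhs_infty_gt.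
  rewrite /expansion linear_sum /= (@big_cat_nat _ _ _ j.+1)//=.
  rewrite [X in _ + X]big_nat [X in _ + X]big1 ?addr0 => [|k /andP[jk _]].
    by apply: eq_bigr => k _; exact: linearZ.
  by rewrite linearZ /= fy0// mulr0.
exists L => // a; split => [/cvg_ex[x ax]|sa].
  rewrite (_ : lower_mul L a = fun j => dot (f j) x); first exact: bessel.
  by apply/funext => j; rewrite (dotL _ _ _ ax).
have [x [_ xa]] := riesz_fischer fo sa.
have [b [bx _]] := hy x.
rewrite (_ : a = b); first exact: cvgP bx.
apply: (@lower_mul_inj _ L) => //; apply/funext => j.
by rewrite -xa (dotL _ _ _ bx).
Unshelve. all: by end_near. Qed.

Theorem theorem1p3 (R : realType) (y : nat -> ell2 R) (hy : schauder_basis y) :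
  borel_bireducible (basis_equiv y) (@mod_ell2 R).
Proof.
have [L L0 coefL] := coef_lower_mul hy.
have [eta eta_cont etaK] := lower_mul_section L0.
split.
  exists (lower_mul L).
    by apply: continuous_borel_fun; exact: lower_mul_continuous.
  by move=> a b; rewrite /mod_ell2 -lower_mulB; exact: coefL.
exists eta; first exact: continuous_borel_fun.
by move=> a b; rewrite /basis_equiv /mod_ell2 coefL lower_mulB !etaK.
Qed.
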